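(* Let $f\in\mathcal{C}^4(I)$, let $y_i=f(x_i)$ for $i=1,\dots,N$, and let $S$ and $s$ be, respectively, the rational cubic spline FIF (with scaling factors $\alpha_i$, $|\alpha_i|\le\kappa a_i$, $0\le\kappa<1$, and shape parameters $r_i>-1$) and the classical rational cubic spline (with the same shape parameters) for the data $\{(x_i,y_i): i=1,\dots,N\}$, with $S^{(1)}(x_i)=s^{(1)}(x_i)=d_i$ for $i=1,\dots,N$. Suppose that, for some real constant $Z_0$, the rational functions $R_i$ generating $S$ satisfy $$\left|\frac{\partial R_i(\tau_i,\phi)}{\partial\alpha_i}\right|\le Z_0\quad\text{for } |\tau_i|\in(0,\kappa a_i),\ \phi\in[0,1],\ \text{and all } i\in J.$$ Then $$\begin{aligned}\|f-S\|_\infty\le{}&\frac{h}{4c}\max_{i\in J}\max\big\{|y_i^{(1)}-d_i|,\,|y_{i+1}^{(1)}-d_{i+1}|\big\}\\&+\frac{1}{384c}\Big\{h^4\|f^{(4)}\|_\infty\Big(1+\tfrac14\max_{i\in J}|r_i-3|\Big)+4\max_{i\in J}|r_i-3|\big(h^3\|f^{(3)}\|_\infty+3h^2\|f^{(2)}\|_\infty\big)\Big\}\\&+\frac{|\alpha|_\infty(\|s\|_\infty+Z_0)}{1-|\alpha|_\infty},\end{aligned}$$ where $y_i^{(1)}=f^{(1)}(x_i)$, $|\alpha|_\infty=\max\{|\alpha_i|: i\in J\}$, $h=\max\{h_i:i\in J\}$, and $c=\min\{c_i: i\in J\}$ with $c_i=\frac{1+r_i}{4}$ if $-1<r_i<3$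 and $c_i=1$ if $r_i\ge 3$.
   Context: Let $N\ge2$, $x_1<x_2<\dots<x_N$, $I=[x_1,x_N]$, $J=\{1,\dots,N-1\}$, $h_i=x_{i+1}-x_i$, $a_i=h_i/(x_N-x_1)$, and let $L_i(x)=a_ix+b_i$ be the affine map with $L_i(x_1)=x_i$, $L_i(x_N)=x_{i+1}$. $\|\cdot\|_\infty$ is the uniform norm on $I$, and $f^{(k)}$ is the $k$-th derivative. Given values $y_i$, derivative parameters $d_i$ ($i=1,\dots,N$), scaling factors $\alpha_i$ with $|\alpha_i|\le\kappa a_i$ ($i\in J$, $0\le\kappa<1$ fixed) and shape parameters $r_i>-1$ ($i\in J$), the rational cubic spline FIF is the unique function $S\in\mathcal{C}^1(I)$ satisfying $$S(L_i(x))=\alpha_iS(x)+R_i(\alpha_i,\theta),\qquad \theta=\frac{x-x_1}{x_N-x_1},\quad x\in I,\ i\in J,$$ where, for real $\alpha_i$ and $\phi\in[0,1]$, $$R_i(\alpha_i,\phi)=\frac{P_i(\alpha_i,\phi)}{Q_i(\phi)},\qquad Q_i(\phi)=1+(r_i-3)\phi(1-\phi),$$ $$\begin{aligned}P_i(\alpha_i,\phi)={}&(y_i-\alpha_iy_1)(1-\phi)^3+\{[r_iy_i+h_id_i]-\alpha_i[r_iy_1+d_1(x_N-x_1)]\}\phi(1-\phi)^2\\&+\{[r_iy_{i+1}-h_id_{i+1}]-\alpha_i[r_iy_N-d_N(x_N-x_1)]\}\phi^2(1-\phi)+(y_{i+1}-\alpha_iy_N)\phi^3.\end{aligned}$$ It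 satisfies $S(x_i)=y_i$ and $S^{(1)}(x_i)=d_i$ for all $i$. The classical rational cubic spline $s\in\mathcal{C}^1(I)$ is the case of all $\alpha_i=0$, i.e. $s(x)=R_i(0,\phi)$ with $\phi=(x-x_i)/h_i$ for $x\in[x_i,x_{i+1}]$. The notation $\partial R_i(\tau_i,\phi)/\partial\alpha_i$ means the partial derivative of $R_i$ in its first argument, evaluated at $(\tau_i,\phi)$. *)

(* Defs.v *)
From HB Require Import structures.
From mathcomp Require Import all_boot all_order all_algebra.
From mathcomp Require Import all_classical all_reals all_analysis.

Set Implicit Arguments.
Unset Strict Implicit.
Unset Printing Implicit Defensive.

Import Order.TTheory GRing.Theory Num.Theory.
Import numFieldNormedType.Exports.

Local Open Scope classical_set_scope.
Local Open Scope ring_scope.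

(* Difference quotients are restricted to A, so at the endpoints of a compact
   interval the derivative is the one-sided one and the values of f outside A
   play no role. *)
Definition derivable_in (R : realType) (A : set R) (f : R -> R) (t : R) : Prop :=
  cvg ((f u - f t) / (u - t) @[u --> within A t^']).

Definition derive_in (R : realType) (A : set R) (f : R -> R) (t : R) : R :=
  lim ((f u - f t) / (u - t) @[u --> within A t^']).

Definition derive_in_n (R : realType) (A : set R) (k : nat) (f : R -> R) :
  R -> R := iter k (derive_in A) f.

Definition Ck_on (R : realType) (A : set R) (n : nat) (f : R -> R) : Prop :=
  (forall k, (k < n)%N -> forall t, A t -> derivable_in A (derive_in_n A k f) t)
  /\ (forall k, (k <= n)%N -> {within A, continuous (derive_in_n A k f)}).

(* sup is a real number; it is the actual least upper bound as soon as g is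
   bounded on the nonempty set A, e.g. g continuous on a compact interval. *)
Definition unif_norm (R : realType) (A : set R) (g : R -> R) : R :=
  sup [set `|g t| | t in A].

(* The knots are x 1, ..., x N (with N >= 2), and an index i of J is a natural
   number such that 1 <= i < N. Other values of the sequences are unused. *)
Definition knot_interval (R : realType) (N : nat) (x : nat -> R) : set R :=
  `[x 1%N, x N].

Definition hstep (R : realType) (x : nat -> R) (i : nat) : R := x i.+1 - x i.

Definition hratio (R : realType) (N : nat) (x : nat -> R) (i : nat) : R :=
  hstep x i / (x N - x 1%N).

Definition Lmap (R : realType) (N : nat) (x : nat -> R) (i : nat) (t : R) : R :=
  hratio N x i * t + (x i - hratio N x i * x 1%N).

Lemma Lmap_left (R : realType) (N : nat) (x : nat -> R) (i : nat) :
  Lmap N x i (x 1%N) = x i.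
Proof. by rewrite /Lmap addrCA subrr addr0. Qed.

Lemma Lmap_right (R : realType) (N : nat) (x : nat -> R) (i : nat) :
  x 1%N < x N -> Lmap N x i (x N) = x i.+1.
Proof.
move=> x1N; rewrite /Lmap addrCA -mulrBr /hratio divfK; last first.
  by rewrite subr_eq0 gt_eqF.
by rewrite /hstep addrC subrK.
Qed.

Definition theta (R : realType) (N : nat) (x : nat -> R) (t : R) : R :=
  (t - x 1%N) / (x N - x 1%N).

Definition Qden (R : realType) (r : nat -> R) (i : nat) (phi : R) : R :=
  1 + (r i - 3) * phi * (1 - phi).

Definition Pnum (R : realType) (N : nat) (x y d r : nat -> R) (i : nat)
    (a phi : R) : R :=
  (y i - a * y 1%N) * (1 - phi) ^+ 3
  + ((r i * y i + hstep x i * d i)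
     - a * (r i * y 1%N + d 1%N * (x N - x 1%N))) * phi * (1 - phi) ^+ 2
  + ((r i * y i.+1 - hstep x i * d i.+1)
     - a * (r i * y N - d N * (x N - x 1%N))) * phi ^+ 2 * (1 - phi)
  + (y i.+1 - a * y N) * phi ^+ 3.

Definition Rrat (R : realType) (N : nat) (x y d r : nat -> R) (i : nat)
    (a phi : R) : R :=
  Pnum N x y d r i a phi / Qden r i phi.

(* Under the standing assumptions |alpha i| <= kappa * hratio N x i, kappa < 1
   and r i > -1, exactly one function on the knot interval satisfies this. *)
Definition rational_cubic_FIF (R : realType) (N : nat)
    (x y d r alpha : nat -> R) (S : R -> R) : Prop :=
  Ck_on (knot_interval N x) 1 S /\
  (forall i, (1 <= i < N)%N -> forall t, knot_interval N x t ->
     S (Lmap N x i t)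
       = alpha i * S t + Rrat N x y d r i (alpha i) (theta N x t)).

Definition classical_rational_cubic_spline (R : realType) (N : nat)
    (x y d r : nat -> R) (s : R -> R) : Prop :=
  rational_cubic_FIF N x y d r (fun _ => 0) s.

(* Only used for nonnegative families, for which the unit 0 is harmless. *)
Definition maxJ (R : realType) (N : nat) (F : nat -> R) : R :=
  \big[Num.max/0]_(1 <= i < N) F i.

Definition cshape (R : realType) (r : nat -> R) (i : nat) : R :=
  if r i < 3 then (1 + r i) / 4 else 1.

(* The unit 1 of the minimum is harmless, since cshape r i <= 1. *)
Definition cmin (R : realType) (N : nat) (r : nat -> R) : R :=
  \big[Num.min/1]_(1 <= i < N) cshape r i.

(* Main.v *)
Require Import Defs.
From HB Require Import structures.
From mathcomp Require Import all_boot all_order all_algebra.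
From mathcomp Require Import all_classical all_reals all_analysis.
From mathcomp Require Import ring lra.
Import Order.TTheory GRing.Theory Num.Theory.
Import numFieldNormedType.Exports.
Local Open Scope classical_set_scope.
Local Open Scope ring_scope.

(* Each R_i is affine in its first argument, so its derivative in alpha_i is the
   slope T_i and |T_i| <= Z0. Subtracting the two functional equations gives
   S(L_i u) - s(L_i u) = alpha_i (S u + T_i), and taking norms yields
   |S - s| (1 - |alpha|) <= |alpha| (|s| + Z0).
   On a subinterval, write s = P / Q. If the d_i are the exact derivatives of f,
   then P is the cubic Hermite interpolant of f Q, whose error is controlled by
   the fourth derivative of f Q; as Q is quadratic, only three terms of its
   Leibniz expansion survive. Replacing the exact derivatives by the d_i perturbs
   P by at most h / 4 times the largest error on the derivatives, and Q >= c. *)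

(** * Restricted derivatives and repeated use of Rolle's theorem *)

(** Around an interior point, a ball of radius at most [t - a] and [b - t] lies in [[a, b]], so the
    difference quotient restricted to the interval has the same limit as the two-sided one. *)
Lemma is_derive_derive_in (R : realType) (a b : R) (f : R -> R) (t : R) :
  a < t < b -> derivable_in `[a, b] f t ->
  is_derive t 1 f (derive_in `[a, b] f t).
Proof.
move=> /andP[ta tb] fl.
have sh : (h + t) @[h --> (0 : R)^'] --> within `[a, b] t^'.
  move=> P; rewrite /within /= => /nbhs_ballP[e /= e0 eP].
  have I_gt0 : 0 < Num.min e (Num.min (t - a) (b - t)).
    by rewrite !lt_min e0 !subr_gt0 ta tb.
  apply/nbhs_ballP; exists (Num.min e (Num.min (t - a) (b - t))) => //= h.
  rewrite /ball /= sub0r normrN !lt_min => /and3P[he hta htb] h0.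
  apply: eP => /=.
  - by rewrite /ball /= opprD addrCA subrr addr0 normrN.
  - by rewrite -subr_eq0 addrK.
  - rewrite in_itv /=; move: hta htb; rewrite !ltr_norml.
    by move=> /andP[? ?] /andP[? ?]; apply/andP; split; lra.
have cv : h^-1 *: ((f \o shift t) (h *: 1) - f t) @[h --> (0 : R)^']
            --> derive_in `[a, b] f t.
  have fl' : (f u - f t) / (u - t) @[u --> within `[a, b] t^']
      --> derive_in `[a, b] f t by exact: fl.
  apply: cvg_trans (cvg_comp _ _ sh fl'); apply: near_eq_cvg.
  by near=> h; rewrite /= addrK mulrC /GRing.scale /= mulr1.
by split; [apply/cvg_ex; eexists; exact: cv | exact/cvg_lim].
Unshelve. all: by end_near. Qed.

Lemma Rolle_is_derive (R : realType) (a b : R) (g g' : R -> R) :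
  a < b -> {within `[a, b], continuous g} ->
  (forall t, a < t < b -> is_derive t 1 g (g' t)) -> g a = g b ->
  exists2 c, a < c < b & g' c = 0.
Proof.
move=> ab gc gd gab; have gd' t : t \in `]a, b[%R -> derivable g t 1.
  by rewrite in_itv /= => /gd [].
have [c cab c0] := Rolle ab gd' gc gab.
move: cab; rewrite in_itv /= => cab; exists c => //.
by have [_ <-] := gd c cab; have [_ ->] := c0.
Qed.

Lemma within_itv_sub (R : realType) (a b a' b' : R) (g : R -> R) :
  a <= a' -> b' <= b -> {within `[a, b], continuous g} ->
  {within `[a', b'], continuous g}.
Proof.
move=> aa bb; apply: continuous_subspaceW => t /=; rewrite !in_itv /=.
by move=> /andP[? ?]; apply/andP; split; lra.
Qed.

(* Counts zeros: G 0 has three, G 1 has four (two of them the end points),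
   hence G 2, G 3 and G 4 have at least three, two and one. *)
Lemma Rolle4 (R : realType) (a t0 b : R) (G : nat -> R -> R) :
  a < t0 < b ->
  (forall k, (k < 4)%N -> {within `[a, b], continuous (G k)}) ->
  (forall k, (k < 4)%N -> forall t, a < t < b ->
     is_derive t 1 (G k) (G k.+1 t)) ->
  G 0%N a = 0 -> G 0%N t0 = 0 -> G 0%N b = 0 -> G 1%N a = 0 -> G 1%N b = 0 ->
  exists2 xi, a < xi < b & G 4 xi = 0.
Proof.
move=> /andP[at0 t0b] Gc Gd G0a G0t G0b G1a G1b.
have rolle k u v : (k < 4)%N -> a <= u -> u < v -> v <= b ->
    G k u = 0 -> G k v = 0 -> exists2 c, u < c < v & G k.+1 c = 0.
  move=> k4 au uv vb Gu Gv; apply: (@Rolle_is_derive _ u v (G k)) => //.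
  - exact: within_itv_sub (Gc k k4).
  - by move=> t /andP[? ?]; apply: Gd => //; apply/andP; split; lra.
  - by rewrite Gu Gv.
have [u /andP[au ut0] Gu] := rolle 0%N a t0 isT (lexx _) at0 (ltW t0b) G0a G0t.
have [v /andP[t0v vb] Gv] := rolle 0%N t0 b isT (ltW at0) t0b (lexx _) G0t G0b.
have uv := lt_trans ut0 t0v.
have le_b w : w < v -> w <= b by lra.
have ge_a w : u < w -> a <= w by lra.
have [u1 /andP[au1 u1u] Gu1] :=
  rolle 1%N a u isT (lexx _) au (le_b _ uv) G1a Gu.
have [u2 /andP[uu2 u2v] Gu2] := rolle 1%N u v isT (ltW au) uv (ltW vb) Gu Gv.
have [u3 /andP[vu3 u3b] Gu3] :=
  rolle 1%N v b isT (ge_a _ uv) vb (lexx _) Gv G1b.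
have [v1 /andP[u1v1 v1u2] Gv1] :=
  rolle 2 u1 u2 isT (ltW au1) (lt_trans u1u uu2) (le_b _ u2v) Gu1 Gu2.
have [v2 /andP[u2v2 v2u3] Gv2] :=
  rolle 2 u2 u3 isT (ge_a _ uu2) (lt_trans u2v vu3) (ltW u3b) Gu2 Gu3.
have [||xi /andP[? ?] ?] :=
  rolle 3 v1 v2 isT _ (lt_trans v1u2 u2v2) _ Gv1 Gv2; [lra|lra|].
by exists xi => //; apply/andP; split; lra.
Qed.

Lemma within_continuousM_horner (R : realType) (a b : R) (f : R -> R)
    (q : {poly R}) :
  {within `[a, b], continuous f} ->
  {within `[a, b], continuous (f * horner q)}.
Proof.
move=> fc t; apply: cvgM; first exact: fc.
by apply: continuous_subspaceT; exact: continuous_horner.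
Qed.

Lemma Rolle4_Leibniz (R : realType) (a t0 b : R) (F : nat -> R -> R)
    (q p : {poly R}) :
  a < t0 < b ->
  (forall k, (k < 4)%N -> {within `[a, b], continuous (F k)}) ->
  (forall k, (k < 4)%N -> forall t, a < t < b ->
     is_derive t 1 (F k) (F k.+1 t)) ->
  q^`(3) = 0 ->
  F 0%N a * q.[a] + p.[a] = 0 ->
  F 0%N t0 * q.[t0] + p.[t0] = 0 ->
  F 0%N b * q.[b] + p.[b] = 0 ->
  F 1%N a * q.[a] + F 0%N a * q^`().[a] + p^`().[a] = 0 ->
  F 1%N b * q.[b] + F 0%N b * q^`().[b] + p^`().[b] = 0 ->
  exists2 xi, a < xi < b &
    F 4 xi * q.[xi] + 4 * (F 3 xi * q^`().[xi]) + 6 * (F 2 xi * q^`(2).[xi])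
      + p^`(4).[xi] = 0.
Proof.
move=> atb Fc Fd q3 h0a h0t h0b h1a h1b.
pose P k m : R -> R := F k * horner q^`(m).
have Pc k m : (k < 4)%N -> {within `[a, b], continuous (P k m)}.
  by move=> k4; exact/within_continuousM_horner/Fc.
have pc (p' : {poly R}) : {within `[a, b], continuous (horner p')}.
  by apply: continuous_subspaceT; exact: continuous_horner.
have Pd k m t : (k < 4)%N -> a < t < b ->
    is_derive t 1 (P k m) (P k.+1 m t + P k m.+1 t).
  move=> k4 tab; have Fd' := Fd k k4 t tab.
  by apply: is_derive_eq; rewrite /P /GRing.scale /= !fctE; ring.
have pd n (t : R) : is_derive t (1 : R) (horner p^`(n)) p^`(n.+1).[t].
  by rewrite derivnS; exact: is_derive_poly.
have P3 k t : P k 3 t = 0 by rewrite /P !fctE q3 horner0 mulr0.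
have PE k m t : P k m t = F k t * q^`(m).[t] by [].
clearbody P.
(* [G k] is the [k]-th derivative of [F 0 * q + p] for [k <= 4]. The terms [P 0 3] in [G 3], and
   [P 1 3] and [P 0 4] in [G 4], are left out because they are zero. *)
pose G k : R -> R := match k with
  | 0 => P 0%N 0%N + horner p^`(0)
  | 1 => P 1%N 0%N + P 0%N 1%N + horner p^`(1)
  | 2 => P 2 0%N + 2 *: P 1%N 1%N + P 0%N 2 + horner p^`(2)
  | 3 => P 3 0%N + 3 *: P 2 1%N + 3 *: P 1%N 2 + horner p^`(3)
  | _ => P 4 0%N + 4 *: P 3 1%N + 6 *: P 2 2 + horner p^`(4)
  end.
have cD (f g : R -> R) : {within `[a, b], continuous f} ->
    {within `[a, b], continuous g} -> {within `[a, b], continuous (f + g)}.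
  by move=> fc gc t; apply: cvgD; [exact: fc|exact: gc].
have cZ (c : R) (f : R -> R) : {within `[a, b], continuous f} ->
    {within `[a, b], continuous (c *: f)}.
  by move=> fc t; apply: cvgZr; exact: fc.
have Gc k : (k < 4)%N -> {within `[a, b], continuous (G k)}.
  case: k => [|[|[|[|//]]]] _ /=.
  - by apply: (cD); [exact: Pc|exact: pc].
  - by apply: (cD); [apply: (cD); exact: Pc|exact: pc].
  - apply: (cD); last exact: pc.
    by apply: (cD); [apply: (cD); [|apply: (cZ)]|]; exact: Pc.
  - apply: (cD); last exact: pc.
    by apply: (cD); [apply: (cD); [|apply: (cZ)]|apply: (cZ)]; exact: Pc.
have dD (f g : R -> R) (df dg t : R) : is_derive t 1 f df ->
    is_derive t 1 g dg -> is_derive t 1 (f + g) (df + dg).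
  exact: is_deriveD.
have dZ (c : R) (f : R -> R) (df t : R) : is_derive t 1 f df ->
    is_derive t 1 (c *: f) (c * df).
  exact: is_deriveZ.
have Gd k : (k < 4)%N -> forall t, a < t < b -> is_derive t 1 (G k) (G k.+1 t).
  have Pd' k' m t tab k4 := Pd k' m t k4 tab.
  case: k => [|[|[|[|//]]]] _ t tab.
  - by refine (is_derive_eq (dD _ _ _ _ _ (Pd' _ _ _ tab _) (pd _ _)) _).
  - refine (is_derive_eq (dD _ _ _ _ _ (dD _ _ _ _ _
      (Pd' _ _ _ tab _) (Pd' _ _ _ tab _)) (pd _ _)) _) => //.
    by rewrite /= !fctE /GRing.scale /=; ring.
  - refine (is_derive_eq (dD _ _ _ _ _ (dD _ _ _ _ _ (dD _ _ _ _ _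
      (Pd' _ _ _ tab _) (dZ _ _ _ _ (Pd' _ _ _ tab _)))
      (Pd' _ _ _ tab _)) (pd _ _)) _) => //.
    by rewrite P3 /= !fctE /GRing.scale /=; ring.
  - refine (is_derive_eq (dD _ _ _ _ _ (dD _ _ _ _ _ (dD _ _ _ _ _
      (Pd' _ _ _ tab _) (dZ _ _ _ _ (Pd' _ _ _ tab _)))
      (dZ _ _ _ _ (Pd' _ _ _ tab _))) (pd _ _)) _) => //.
    by rewrite P3 /= !fctE /GRing.scale /=; ring.
have [xi xiab Gxi] : exists2 xi, a < xi < b & G 4 xi = 0.
  by apply: (@Rolle4 _ a t0 b G) => //; rewrite /= !fctE !PE.
by exists xi => //; rewrite -Gxi /= !fctE !PE.
Qed.

(** * Hermite interpolation error for the product f Q *)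

(** Polynomials are kept in powers of [u]. When [u] is affine, differentiation preserves this form
    and only changes the coefficients, so all interpolation conditions reduce to field
    identities. *)
Definition quartic {R : comNzRingType} (u : {poly R}) (c0 c1 c2 c3 c4 : R) :
  {poly R} :=
  c0%:P + c1%:P * u + c2%:P * u ^+ 2 + c3%:P * u ^+ 3 + c4%:P * u ^+ 4.

Lemma horner_quartic (R : comNzRingType) (u : {poly R}) (c0 c1 c2 c3 c4 t : R) :
  (quartic u c0 c1 c2 c3 c4).[t] = c0 + c1 * u.[t] + c2 * u.[t] ^+ 2
    + c3 * u.[t] ^+ 3 + c4 * u.[t] ^+ 4.
Proof. by rewrite /quartic !hornerE. Qed.

Lemma deriv_quartic (R : comNzRingType) (u : {poly R}) (k : R)
    (c0 c1 c2 c3 c4 : R) : u^`() = k%:P ->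
  (quartic u c0 c1 c2 c3 c4)^`()
    = quartic u (k * c1) (2 * k * c2) (3 * k * c3) (4 * k * c4) 0.
Proof.
move=> uk; rewrite /quartic !(derivD, derivM, derivC, uk).
rewrite !rmorphM /= !(rmorph_nat, rmorph1, rmorph0).
ring.
Qed.

(** The classical remainder argument: the error is [K * w] with [w = phi^2 (1 - phi)^2], where [w]
    has double zeros at both ends. Subtracting [K * w] adds a zero at [t], so the fourth derivative
    vanishes at some [xi], which expresses [24 K] through [F 2], [F 3] and [F 4]. As [w <= 1/16],
    the constant is [24 * 16 = 384]. *)
Lemma rational_Hermite_error (R : realType) (a b rho M2 M3 M4 : R)
    (F : nat -> R -> R) (t h phi : R) :
  a < b ->
  (forall k, (k < 4)%N -> {within `[a, b], continuous (F k)}) ->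
  (forall k, (k < 4)%N -> forall t, a < t < b ->
     is_derive t 1 (F k) (F k.+1 t)) ->
  (forall t, a < t < b -> `|F 2 t| <= M2) ->
  (forall t, a < t < b -> `|F 3 t| <= M3) ->
  (forall t, a < t < b -> `|F 4 t| <= M4) ->
  a <= t <= b -> h = b - a -> phi = (t - a) / h ->
  `|F 0%N t * (1 + (rho - 3) * phi * (1 - phi))
    - (F 0%N a * (1 - phi) ^+ 3
       + (rho * F 0%N a + h * F 1%N a) * phi * (1 - phi) ^+ 2
       + (rho * F 0%N b - h * F 1%N b) * phi ^+ 2 * (1 - phi)
       + F 0%N b * phi ^+ 3)|
  <= (h ^+ 4 * M4 * (1 + 1 / 4 * `|rho - 3|)
      + 4 * `|rho - 3| * (h ^+ 3 * M3 + 3 * h ^+ 2 * M2)) / 384.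
Proof.
move=> ab Fc Fd hM2 hM3 hM4 /andP[le_at le_tb] hE phiE.
have h_gt0 : 0 < h by rewrite hE subr_gt0.
have h0 : h != 0 by rewrite gt_eqF.
set c := rho - 3.
set E := (F 0%N t * _ - _).
have M_ge0 : [/\ 0 <= M2, 0 <= M3 & 0 <= M4].
  have mab : a < (a + b) / 2 < b by apply/andP; split; lra.
  by split; [exact: le_trans (hM2 _ mab)|exact: le_trans (hM3 _ mab)
            |exact: le_trans (hM4 _ mab)].
have [M20 M30 M40] := M_ge0.
have rhs_ge0 : 0 <= (h ^+ 4 * M4 * (1 + 1 / 4 * `|c|)
      + 4 * `|c| * (h ^+ 3 * M3 + 3 * h ^+ 2 * M2)) / 384.
  have h_ge0 := ltW h_gt0.
  apply: divr_ge0; last exact: ler0n.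
  have ? := normr_ge0 c; have ? k := exprn_ge0 k h_ge0.
  by apply: addr_ge0; rewrite !(mulr_ge0, addr_ge0, divr_ge0).
(* At the two end points the error is zero. They are treated apart because [K] divides by [w], which
   vanishes there. *)
have [ta|/negP ta] := boolP (t == a).
  rewrite (_ : E = 0) ?normr0 // /E phiE (eqP ta) subrr; ring.
have [tb|/negP tb] := boolP (t == b).
  rewrite (_ : E = 0) ?normr0 // /E phiE (eqP tb) -hE divff //; ring.
have tab : a < t < b.
  rewrite !lt_neqAle le_at le_tb eq_sym !andbT.
  by apply/andP; split; exact/negP.
have /andP[lt_at lt_tb] := tab.
have phi01 : 0 < phi < 1.
  by rewrite phiE divr_gt0 ?subr_gt0 // ltr_pdivrMr // mul1r hE ltrD2r.
have /andP[phi0 phi1] := phi01.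
have w_gt0 : 0 < phi ^+ 2 * (1 - phi) ^+ 2.
  by rewrite mulr_gt0 ?exprn_gt0 ?subr_gt0.
pose K := E / (phi ^+ 2 * (1 - phi) ^+ 2).
pose u : {poly R} := h^-1%:P * ('X - a%:P).
have ut s : u.[s] = (s - a) / h by rewrite /u !hornerE mulrC.
have du : u^`() = (h^-1)%:P by rewrite /u derivM derivC derivXsubC; ring.
pose A := rho * F 0%N a + h * F 1%N a.
pose B := rho * F 0%N b - h * F 1%N b.
(* In the variable phi, q is Q and p is - P - K phi^2 (1 - phi)^2, where K makes
   F 0 q + p vanish at t too. *)
pose q := quartic u 1 c (- c) 0 0.
pose p := quartic u (- F 0%N a) (3 * F 0%N a - A)
  (- 3 * F 0%N a + 2 * A - B - K) (F 0%N a - A + B - F 0%N b + 2 * K) (- K).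
have dq c0 c1 c2 c3 c4 := @deriv_quartic _ u h^-1 c0 c1 c2 c3 c4 du.
have uE : [/\ u.[a] = 0, u.[b] = 1 & u.[t] = phi].
  by rewrite !ut subrr mul0r phiE -hE divff.
have [ua ub utphi] := uE.
have [xi /andP[axi xib]] : exists2 xi, a < xi < b &
    F 4 xi * q.[xi] + 4 * (F 3 xi * q^`().[xi]) + 6 * (F 2 xi * q^`(2).[xi])
      + p^`(4).[xi] = 0.
  apply: (@Rolle4_Leibniz _ a t b) => //.
  - by rewrite /q /= !dq /quartic !mulr0 !polyC0 !mul0r !addr0.
  - by rewrite !horner_quartic ua; ring.
  - rewrite !horner_quartic utphi /K /E -/c -/A -/B.
    by field; rewrite subr_eq0 !gt_eqF.
  - by rewrite !horner_quartic ub /A /B; ring.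
  - by rewrite !dq !horner_quartic ua /A /c; field.
  - by rewrite !dq !horner_quartic ub /A /B /c; field.
rewrite /q /p /= !dq !horner_quartic ut.
set z := (xi - a) / h => Hxi.
have z01 : 0 < z < 1.
  by rewrite /z divr_gt0 ?subr_gt0 // ltr_pdivrMr // mul1r hE ltrD2r.
have /andP[z0 z1] := z01.
have xiab : a < xi < b by rewrite axi.
(* The equation at [xi] multiplied by [h^4]: each derivative of [u] contributes a factor [1/h], and
   the fourth derivative of [p] is [-24 K / h^4]. *)
have K24 : 24 * K = h ^+ 4 * F 4 xi * (1 + c * (z * (1 - z)))
    + 4 * c * (h ^+ 3 * F 3 xi * (1 - 2 * z) - 3 * h ^+ 2 * F 2 xi).
  apply/esym/subr0_eq; rewrite -[RHS](mulr0 (h ^+ 4)) -[in RHS]Hxi; field.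
  exact: h0.
have hK : `|24 * K| <= h ^+ 4 * M4 * (1 + 1 / 4 * `|c|)
      + 4 * `|c| * (h ^+ 3 * M3 + 3 * h ^+ 2 * M2).
  have h_ge0 := ltW h_gt0.
  have zz : `|z * (1 - z)| <= 1 / 4.
    rewrite ger0_norm; last by rewrite mulr_ge0 ?subr_ge0 // ltW.
    by have := sqr_ge0 (2 * z - 1); nra.
  have z2 : `|1 - 2 * z| <= 1 by rewrite ler_norml; apply/andP; split; lra.
  rewrite K24; apply: le_trans (ler_normD _ _) _; apply: lerD.
    rewrite normrM (normrM (h ^+ 4)) (ger0_norm (exprn_ge0 4 h_ge0)).
    apply: ler_pM; rewrite ?mulr_ge0 ?exprn_ge0 //.
      by apply: ler_wpM2l; [exact: exprn_ge0|exact: hM4].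
    apply: le_trans (ler_normD _ _) _; rewrite normr1 lerD2l normrM mulrC.
    by apply: ler_wpM2r.
  rewrite normrM normrM (@ger0_norm _ 4) //.
  apply: ler_wpM2l; first by rewrite mulr_ge0.
  apply: le_trans (ler_normB _ _) _; apply: lerD.
    rewrite normrM (normrM (h ^+ 3)) (ger0_norm (exprn_ge0 3 h_ge0)).
    rewrite -[leRHS]mulr1.
    apply: ler_pM; rewrite ?mulr_ge0 ?exprn_ge0 //.
    by apply: ler_wpM2l; [exact: exprn_ge0|exact: hM3].
  rewrite normrM (normrM 3) (ger0_norm (exprn_ge0 2 h_ge0)) (@ger0_norm _ 3) //.
  by apply: ler_wpM2l; [rewrite mulr_ge0 ?exprn_ge0|exact: hM2].
have -> : E = K * (phi ^+ 2 * (1 - phi) ^+ 2) by rewrite /K divfK // gt_eqF.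
have w16 : phi ^+ 2 * (1 - phi) ^+ 2 <= 1 / 16.
  have : phi * (1 - phi) <= 1 / 4.
    by have := sqr_ge0 (2 * phi - 1); nra.
  have : 0 <= phi * (1 - phi) by rewrite mulr_ge0 ?subr_ge0 ?ltW.
  rewrite -exprMn; nra.
rewrite normrM (ger0_norm (ltW w_gt0)).
apply: le_trans (ler_wpM2l (normr_ge0 _) w16) _.
move: hK; rewrite normrM (@ger0_norm _ 24) //; lra.
Qed.

(** * Uniform norms, extrema over the indices, and the geometry of the knots *)

(** Continuity on a compact interval bounds the set of values, by the extreme value theorem, so that
    its [sup] is a genuine upper bound. *)
Lemma norm_le_unif_norm (R : realType) (a b : R) (g : R -> R) (t : R) :
  {within `[a, b], continuous g} -> a <= t <= b ->
  `|g t| <= unif_norm `[a, b] g.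
Proof.
move=> gc atb; have /andP[le_at le_tb] := atb.
have nc : {within `[a, b], continuous (fun u => `|g u|)}.
  by move=> u; apply: cvg_norm; exact: gc.
have [c _ maxc] := EVT_max (le_trans le_at le_tb) nc.
apply: ub_le_sup; last by exists t; rewrite //= in_itv.
by exists `|g c| => _ [u uab <-]; exact: maxc.
Qed.

Lemma unif_norm_le (R : realType) (a b : R) (g : R -> R) (B : R) :
  a <= b -> (forall t, a <= t <= b -> `|g t| <= B) ->
  unif_norm `[a, b] g <= B.
Proof.
move=> ab gB; apply: ge_sup.
  by exists `|g a|, a; rewrite //= in_itv /= lexx.
by move=> z [t + <-]; rewrite /= in_itv; exact: gB.
Qed.

Lemma le_maxJ (R : realType) (N : nat) (F : nat -> R) (i : nat) :
  (1 <= i < N)%N -> F i <= maxJ N F.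
Proof. by move=> iN; apply: le_bigmax_seq; rewrite // mem_index_iota. Qed.

Lemma maxJ_ge0 (R : realType) (N : nat) (F : nat -> R) : 0 <= maxJ N F.
Proof. exact: bigmax_ge_id. Qed.

Lemma maxJ_le (R : realType) (N : nat) (F : nat -> R) (B : R) :
  0 <= B -> (forall i, (1 <= i < N)%N -> F i <= B) -> maxJ N F <= B.
Proof.
move=> B0 FB; rewrite /maxJ big_nat.
by elim/big_ind: _ => // u v uB vB; rewrite ge_max uB.
Qed.

Lemma cmin_le (R : realType) (N : nat) (r : nat -> R) (i : nat) :
  (1 <= i < N)%N -> cmin N r <= cshape r i.
Proof. by move=> iN; apply: ge_bigmin_seq; rewrite // mem_index_iota. Qed.

Lemma cmin_gt0 (R : realType) (N : nat) (r : nat -> R) :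
  (forall i, (1 <= i < N)%N -> -1 < r i) -> 0 < cmin N r.
Proof.
move=> hr; rewrite /cmin big_nat.
elim/big_ind: _ => // [u v u0 v0|i /hr ri]; first by rewrite lt_min u0.
by rewrite /cshape; case: ifP => // _; rewrite divr_gt0 //; lra.
Qed.

(** The product [phi (1 - phi)] ranges over [[0, 1/4]]. For [r i < 3] the denominator is smallest at
    [1/4], with value [(1 + r i) / 4]; for [r i >= 3] the term added to 1 is nonnegative. *)
Lemma cshape_le_Qden (R : realType) (r : nat -> R) (i : nat) (phi : R) :
  0 <= phi <= 1 -> cshape r i <= Qden r i phi.
Proof.
move=> /andP[phi0 phi1].
have z0 : 0 <= phi * (1 - phi) by rewrite mulr_ge0 // subr_ge0.
have z1 : phi * (1 - phi) <= 1 / 4 by have := sqr_ge0 (2 * phi - 1); nra.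
rewrite /cshape /Qden -mulrA; case: ltP => r3; first by nra.
by rewrite lerDl mulr_ge0 ?subr_ge0.
Qed.

Lemma knot_le (R : realType) (N : nat) (x : nat -> R) (i j : nat) :
  (forall k, (1 <= k < N)%N -> x k < x k.+1) ->
  (1 <= i)%N -> (i <= j <= N)%N -> x i <= x j.
Proof.
move=> hx i1; elim: j => [|j IHj] /andP[ij jN]; first by case: i i1 ij.
move: ij; rewrite leq_eqVlt => /orP[/eqP -> //|ij].
apply: (@le_trans _ _ (x j)); first by apply: IHj; rewrite -ltnS ij ltnW.
by apply/ltW/hx; rewrite jN andbT (leq_trans i1).
Qed.

Lemma knot_piece (R : realType) (N : nat) (x : nat -> R) (t : R) :
  (2 <= N)%N -> x 1%N <= t <= x N ->
  exists2 i, (1 <= i < N)%N & x i <= t <= x i.+1.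
Proof.
elim: N => // N IHN; rewrite ltnS leq_eqVlt => /orP[/eqP<-|N2] /andP[t1 tN].
  by exists 1%N => //; rewrite t1.
have [tlN|tgN] := leP t (x N).
  have [|i /andP[i1 iN] ti] := IHN N2; first by rewrite t1.
  by exists i => //; rewrite i1 ltnW.
by exists N; [rewrite ltnS leqnn ltnW|rewrite ltW].
Qed.

(** Lets the functional equation be read at any point [t] of a piece: the global parameter of the
    preimage [u] is the local parameter of [t]. *)
Lemma Lmap_onto (R : realType) (N : nat) (x : nat -> R) (i : nat) (t : R) :
  x 1%N < x N -> x i < x i.+1 -> x i <= t <= x i.+1 ->
  exists u, [/\ x 1%N <= u <= x N, Lmap N x i u = t
               & theta N x u = (t - x i) / hstep x i].
Proof.
move=> x1N xi /andP[t0 t1].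
have h0 : 0 < hstep x i by rewrite subr_gt0.
have l0 : 0 < x N - x 1%N by rewrite subr_gt0.
have hn0 := gt_eqF h0; have ln0 := gt_eqF l0.
set p := (t - x i) / hstep x i.
have p0 : 0 <= p by rewrite divr_ge0 ?subr_ge0 // ltW.
have p1 : p <= 1 by rewrite ler_pdivrMr // mul1r lerD2r.
exists (x 1%N + p * (x N - x 1%N)); split.
- by apply/andP; split; nra.
- rewrite /Lmap /hratio /p; field; by rewrite hn0 ln0.
- by rewrite /theta addrAC subrr add0r mulfK // ln0.
Qed.

Lemma hratio_itv (R : realType) (N : nat) (x : nat -> R) (i : nat) :
  (forall k, (1 <= k < N)%N -> x k < x k.+1) -> (1 <= i < N)%N ->
  0 < hratio N x i <= 1.
Proof.
move=> hx /andP[i1 iN].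
have xi := hx i; rewrite i1 iN in xi; have {}xi := xi isT.
have x1 : x 1%N <= x i by apply: knot_le hx _ _ => //; rewrite i1 ltnW.
have xN : x i.+1 <= x N by apply: knot_le hx _ _ => //; rewrite iN leqnn.
have l0 : 0 < x N - x 1%N by lra.
rewrite /hratio /hstep; apply/andP; split.
  by apply: divr_gt0; rewrite ?l0 // subr_gt0.
by rewrite ler_pdivrMr // mul1r; lra.
Qed.

(** * Dependence of the rational functions on the scaling factor *)

(** The numerator is affine in the scaling factor and the denominator does not contain it, so the
    increment from 0 to 1 is the slope. *)
Definition Rrat_slope {R : realType} (N : nat) (x y d r : nat -> R) (i : nat)
    (phi : R) : R :=
  Rrat N x y d r i 1 phi - Rrat N x y d r i 0 phi.

Lemma Rrat_affine (R : realType) (N : nat) (x y d r : nat -> R) (i : nat)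
    (a phi : R) :
  Rrat N x y d r i a phi
    = Rrat N x y d r i 0 phi + Rrat_slope N x y d r i phi * a.
Proof. rewrite /Rrat_slope /Rrat /Pnum; ring. Qed.

Lemma derive1_Rrat (R : realType) (N : nat) (x y d r : nat -> R) (i : nat)
    (tau phi : R) :
  derive1 (fun a => Rrat N x y d r i a phi) tau = Rrat_slope N x y d r i phi.
Proof.
under eq_fun do rewrite Rrat_affine.
set T := Rrat_slope _ _ _ _ _ _ _; set C := Rrat _ _ _ _ _ _ _ _.
rewrite derive1E.
have -> : (fun a => C + T * a) = cst C + T *: id by [].
have h : is_derive tau 1 (cst C + T *: id) T.
  have dT : is_derive tau 1 (T *: id) T.
    by refine (is_derive_eq (is_deriveZ _ (is_derive_id tau 1)) _);
      rewrite /GRing.scale /= mulr1.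
  by refine (is_derive_eq (is_deriveD (is_derive_cst C tau 1) dT) _);
    rewrite add0r.
exact: derive_val.
Qed.

(** * Error of the classical rational cubic spline *)

(** The first two summands of the final estimate; [e] stands for the largest derivative error and
    [rho] for the largest [|r_i - 3|]. *)
Definition spline_error_bound {R : realType} (h c e rho M2 M3 M4 : R) : R :=
  h / (4 * c) * e + 1 / (384 * c) *
    (h ^+ 4 * M4 * (1 + 1 / 4 * rho)
     + 4 * rho * (h ^+ 3 * M3 + 3 * h ^+ 2 * M2)).

(** With [H] the numerator for exact end derivatives and [H'] the one for [da], [db], the error is
    [(f Q - H + (H - H')) / Q]. The first difference is the Hermite error, the second is the
    perturbation of the derivatives; the local [hi], [|rho - 3|] and [Q] are then replaced by the
    uniform bounds [h], [rmax] and [c]. *)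
Lemma rational_spline_piece_error (R : realType)
    (a b rho M2 M3 M4 : R) (F : nat -> R -> R) (t hi phi da db h c e rmax : R) :
  a < b ->
  (forall k, (k < 4)%N -> {within `[a, b], continuous (F k)}) ->
  (forall k, (k < 4)%N -> forall t, a < t < b ->
     is_derive t 1 (F k) (F k.+1 t)) ->
  (forall t, a < t < b -> `|F 2 t| <= M2) ->
  (forall t, a < t < b -> `|F 3 t| <= M3) ->
  (forall t, a < t < b -> `|F 4 t| <= M4) ->
  a <= t <= b -> hi = b - a -> phi = (t - a) / hi ->
  hi <= h -> `|rho - 3| <= rmax -> `|F 1%N a - da| <= e ->
  `|F 1%N b - db| <= e -> 0 < c -> c <= 1 + (rho - 3) * phi * (1 - phi) ->
  `|F 0%N t - (F 0%N a * (1 - phi) ^+ 3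
       + (rho * F 0%N a + hi * da) * phi * (1 - phi) ^+ 2
       + (rho * F 0%N b - hi * db) * phi ^+ 2 * (1 - phi)
       + F 0%N b * phi ^+ 3) / (1 + (rho - 3) * phi * (1 - phi))|
  <= spline_error_bound h c e rmax M2 M3 M4.
Proof.
move=> ab Fc Fd hM2 hM3 hM4 tab hiE phiE hih rhor ea eb c0 cQ.
have := @rational_Hermite_error _ _ _ rho _ _ _ F t hi phi ab Fc Fd hM2 hM3 hM4
  tab hiE phiE.
set Q := 1 + _ in cQ *.
have Q0 : 0 < Q by exact: lt_le_trans cQ.
have hi0 : 0 < hi by rewrite hiE subr_gt0.
have mab : a < (a + b) / 2 < b by apply/andP; split; lra.
have M20 := le_trans (normr_ge0 _) (hM2 _ mab).
have M30 := le_trans (normr_ge0 _) (hM3 _ mab).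
have M40 := le_trans (normr_ge0 _) (hM4 _ mab).
have /andP[le_at le_tb] := tab.
have phi0 : 0 <= phi by rewrite phiE divr_ge0 ?subr_ge0 // ltW.
have phi1 : phi <= 1 by rewrite phiE ler_pdivrMr // mul1r hiE lerD2r.
clear Fc Fd hM2 hM3 hM4 phiE mab tab le_at le_tb.
set y0 := F 0%N a; set y1 := F 0%N b; set f := F 0%N t.
set m0 := F 1%N a in ea *; set m1 := F 1%N b in eb *.
set H := (_ + y1 * _); set H' := (_ + y1 * _).
set B := (_ + _ * (_ + _)) => hB.
have hD : `|H - H'| <= hi / 4 * e.
  (* Only the two middle terms differ. The last factor is at most [e], its weights [1 - phi] and
     [phi] summing to 1, and [phi (1 - phi) <= 1/4] gives the constant [1/4]. *)
  have -> : H - H' = hi * (phi * (1 - phi))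
      * ((m0 - da) * (1 - phi) - (m1 - db) * phi) by rewrite /H /H'; ring.
  have z0 : 0 <= phi * (1 - phi) by rewrite mulr_ge0 // subr_ge0.
  have z1 : phi * (1 - phi) <= 1 / 4.
    by have := sqr_ge0 (2 * phi - 1); nra.
  rewrite normrM (ger0_norm (mulr_ge0 (ltW hi0) z0)).
  apply: ler_pM => //; first exact: mulr_ge0 (ltW hi0) z0.
    by rewrite ler_wpM2l ?(ltW hi0) // -div1r.
  apply: le_trans (ler_normB _ _) _; rewrite !normrM.
  rewrite (ger0_norm phi0) (@ger0_norm _ (1 - phi)) ?subr_ge0 //.
  have := ler_wpM2r phi0 eb.
  have : `|m0 - da| * (1 - phi) <= e * (1 - phi).
    by rewrite ler_wpM2r // subr_ge0.
  lra.
have hB' : B <= h ^+ 4 * M4 * (1 + 1 / 4 * rmax)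
    + 4 * rmax * (h ^+ 3 * M3 + 3 * h ^+ 2 * M2).
  have hp k : hi ^+ k <= h ^+ k by apply: lerXn2r; rewrite ?nnegrE; lra.
  have hp0 k : 0 <= hi ^+ k by apply: exprn_ge0; exact: ltW.
  have rho0 := normr_ge0 (rho - 3).
  apply: lerD; apply: ler_pM => //.
  - exact: mulr_ge0.
  - exact: ler_wpM2r.
  - lra.
  - by apply: addr_ge0; rewrite !mulr_ge0 // ltW.
  - exact: ler_wpM2l.
  - by apply: lerD; rewrite ler_wpM2r // ler_wpM2l.
have e0 := le_trans (normr_ge0 _) ea.
have -> : f - H' / Q = (f * Q - H + (H - H')) / Q.
  by field; rewrite gt_eqF.
rewrite normrM normfV (gtr0_norm Q0) ler_pdivrMr //.
set E := spline_error_bound _ _ _ _ _ _ _.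
have hE : E * c = h / 4 * e + (h ^+ 4 * M4 * (1 + 1 / 4 * rmax)
    + 4 * rmax * (h ^+ 3 * M3 + 3 * h ^+ 2 * M2)) / 384.
  by rewrite /E /spline_error_bound; field; rewrite gt_eqF.
have he : hi / 4 * e <= h / 4 * e by rewrite ler_wpM2r // ler_pM2r.
have B0 := le_trans (normr_ge0 _) hB.
have Ec : `|f * Q - H| + `|H - H'| <= E * c by rewrite hE; lra.
(* The sign of [E] is what allows passing from [E * c] to [E * Q] when [c <= Q]. *)
have E0 : 0 <= E.
  by rewrite -(pmulr_lge0 _ c0); apply: le_trans (Ec); rewrite addr_ge0.
apply: le_trans (ler_normD _ _) _; apply: le_trans Ec _.
exact: ler_wpM2l.
Qed.

Lemma classical_spline_error (R : realType) (N : nat) (x y d r : nat -> R)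
    (f s : R -> R) (t : R) :
  (2 <= N)%N -> (forall i, (1 <= i < N)%N -> x i < x i.+1) ->
  (forall i, (1 <= i < N)%N -> -1 < r i) ->
  Ck_on (knot_interval N x) 4 f ->
  (forall i, (1 <= i <= N)%N -> y i = f (x i)) ->
  classical_rational_cubic_spline N x y d r s -> x 1%N <= t <= x N ->
  `|f t - s t| <= spline_error_bound (maxJ N (hstep x)) (cmin N r)
    (maxJ N (fun i =>
       Num.max `|derive_in_n (knot_interval N x) 1 f (x i) - d i|
               `|derive_in_n (knot_interval N x) 1 f (x i.+1) - d i.+1|))
    (maxJ N (fun i => `|r i - 3|))
    (unif_norm (knot_interval N x) (derive_in_n (knot_interval N x) 2 f))
    (unif_norm (knot_interval N x) (derive_in_n (knot_interval N x) 3 f))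
    (unif_norm (knot_interval N x) (derive_in_n (knot_interval N x) 4 f)).
Proof.
move=> N2 hx hr [fd fc] hy [_ hs] tI.
have [i iN txi] := @knot_piece _ _ _ _ N2 tI.
have xi := hx i iN; have /andP[i1 iltN] := iN.
have x1i : x 1%N <= x i by apply: (knot_le _ _ _ _ _ hx); rewrite // i1 ltnW.
have xiN : x i.+1 <= x N.
  by apply: (knot_le _ _ _ _ _ hx); rewrite // iltN leqnn.
have x1N : x 1%N < x N by lra.
have sub u : x i < u < x i.+1 -> x 1%N < u < x N.
  by move=> /andP[? ?]; apply/andP; split; lra.
have subW u : x i < u < x i.+1 -> x 1%N <= u <= x N.
  by move=> /sub /andP[? ?]; rewrite !ltW.
have h_gt0 : 0 < hstep x i by rewrite subr_gt0.
have [u [uI Lu thu]] := @Lmap_onto _ _ _ _ _ x1N xi txi.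
(* With scaling factor 0 the functional equation at [u] is the explicit formula for [s t] on the
   piece. *)
have := hs i iN u uI; rewrite mul0r add0r Lu thu.
set phi := (t - x i) / hstep x i => ->.
have phi01 : 0 <= phi <= 1.
  have /andP[t0 t1] := txi; apply/andP; split.
    by rewrite divr_ge0 ?subr_ge0 // ltW.
  by rewrite ler_pdivrMr // mul1r lerD2r.
rewrite /Rrat /Pnum /Qden !mul0r !subr0.
rewrite (hy i) ?i1 1?ltnW // (hy i.+1) ?iltN //.
have FM k u' : (k <= 4)%N -> x i < u' < x i.+1 ->
    `|derive_in_n (knot_interval N x) k f u'|
      <= unif_norm (knot_interval N x) (derive_in_n (knot_interval N x) k f).
  by move=> k4 /subW; apply: norm_le_unif_norm; exact: fc.
apply: (@rational_spline_piece_error R (x i) (x i.+1) (r i) _ _ _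
  (fun k => derive_in_n (knot_interval N x) k f)) => //.
- by move=> k k4; apply: (within_itv_sub _ _ _ _ _ _ x1i xiN); exact/fc/ltnW.
(* A point inside a piece is interior to the whole interval, so the restricted derivatives of [f]
   are ordinary ones there. *)
- move=> k k4 v vI; apply: is_derive_derive_in; first exact: sub.
  by apply: fd => //; rewrite /knot_interval /= in_itv /= subW.
- by move=> v; exact: FM.
- by move=> v; exact: FM.
- by move=> v; exact: FM.
- exact: le_maxJ.
- exact: (@le_maxJ _ _ (fun i => `|r i - 3|)).
- apply: le_trans (@le_maxJ _ _ (fun i => Num.max _ _) i iN).
  by rewrite le_max lexx.
- apply: le_trans (@le_maxJ _ _ (fun i => Num.max _ _) i iN).
  by rewrite le_max lexx orbT.
- exact: cmin_gt0.
- by apply: le_trans (cmin_le _ _ _ _ iN) _; exact: cshape_le_Qden.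
Qed.

(** * Distance between the fractal and the classical spline *)

Lemma FIF_classical_dist (R : realType) (N : nat) (x y d alpha r : nat -> R)
    (kappa Z0 : R) (S s : R -> R) :
  (2 <= N)%N -> (forall i, (1 <= i < N)%N -> x i < x i.+1) ->
  0 <= kappa < 1 ->
  (forall i, (1 <= i < N)%N -> `|alpha i| <= kappa * hratio N x i) ->
  rational_cubic_FIF N x y d r alpha S ->
  classical_rational_cubic_spline N x y d r s ->
  (forall i, (1 <= i < N)%N -> forall tau phi : R,
     0 < `|tau| < kappa * hratio N x i -> 0 <= phi <= 1 ->
     `|derive1 (fun a => Rrat N x y d r i a phi) tau| <= Z0) ->
  forall t, x 1%N <= t <= x N ->
  `|s t - S t| <= maxJ N (fun i => `|alpha i|)
    * (unif_norm (knot_interval N x) s + Z0)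
    / (1 - maxJ N (fun i => `|alpha i|)).
Proof.
move=> N2 hx /andP[k0 k1] halpha [[_ Sc] hS] [[_ sc] hs] hZ t tI.
set am := maxJ N _; set ns := unif_norm _ s.
have am0 : 0 <= am by exact: maxJ_ge0.
have alphaE i : (1 <= i < N)%N -> `|alpha i| <= kappa.
  move=> iN; apply: le_trans (halpha i iN) _.
  by have /andP[_ ?] := hratio_itv _ _ _ _ hx iN; rewrite ler_piMr.
have am1 : am < 1 by apply: le_lt_trans k1; exact: maxJ_le.
have x1N : x 1%N < x N.
  apply: (lt_le_trans (hx 1%N N2)); apply: (knot_le _ _ _ _ _ hx) => //.
  by rewrite N2 leqnn.
(* Difference of the two functional equations at the preimage [u] of [v]; the common part
   [R_i(0, theta)] cancels. *)
have piece v : x 1%N <= v <= x N -> exists i u,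
    [/\ (1 <= i < N)%N, x 1%N <= u <= x N &
      s v - S v = - alpha i * (S u + Rrat_slope N x y d r i (theta N x u))].
  move=> vI; have [i iN vxi] := @knot_piece _ _ _ _ N2 vI.
  have [u [uI <- _]] := @Lmap_onto _ _ _ _ _ x1N (hx i iN) vxi.
  exists i, u; split => //.
  by rewrite hs // hS // (Rrat_affine _ _ _ _ _ _ _ (alpha i)); ring.
(* For [kappa = 0] no [tau] is admissible, so [Z0] bounds no slope. All scaling factors are then 0,
   and both sides of the estimate vanish. *)
have [k_eq0|k_neq0] := eqVneq kappa 0.
  have amE : am = 0.
    apply/eqP; rewrite eq_le am0 andbT; apply: maxJ_le => // i iN.
    by rewrite -k_eq0; exact: alphaE.
  have [i [u [iN _ ->]]] := piece t tI.
  have := alphaE i iN; rewrite k_eq0 normr_le0 => /eqP ->.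
  by rewrite oppr0 mul0r normr0 amE !mul0r.
have k_gt0 : 0 < kappa by rewrite lt_neqAle eq_sym k_neq0.
have slopeZ i u : (1 <= i < N)%N -> x 1%N <= u <= x N ->
    `|Rrat_slope N x y d r i (theta N x u)| <= Z0.
  move=> iN /andP[u0 u1].
  have /andP[hr0 _] := hratio_itv _ _ _ _ hx iN.
  have kh : 0 < kappa * hratio N x i by exact: mulr_gt0.
  have l0 : 0 < x N - x 1%N by rewrite subr_gt0.
  (* The slope is the derivative at every [tau]; half the admissible bound is a convenient nonzero
     choice. *)
  rewrite -(derive1_Rrat _ _ _ _ _ _ _ (kappa * hratio N x i / 2)).
  apply: hZ => //; first by rewrite gtr0_norm; [apply/andP; split|]; lra.
  rewrite /theta; apply/andP; split; first by rewrite divr_ge0 ?subr_ge0 // ltW.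
  by rewrite ler_pdivrMr // mul1r lerD2r.
pose D v := s v - S v; pose m := unif_norm (knot_interval N x) D.
have Dc : {within knot_interval N x, continuous D}.
  by move=> v; apply: cvgB; [exact: (sc 0%N)|exact: (Sc 0%N)].
have Dm v : x 1%N <= v <= x N -> `|D v| <= m by exact: norm_le_unif_norm.
have sm v : x 1%N <= v <= x N -> `|s v| <= ns.
  by apply: norm_le_unif_norm; exact: (sc 0%N).
(* Bounding [|S u|] by [|s u| + |D u|] makes [m] appear on both sides; [am < 1] then allows solving
   for [m]. *)
have mle : m <= am * (m + ns + Z0).
  apply: unif_norm_le (ltW x1N) _ => v vI.
  have [i [u [iN uI]]] := piece v vI; rewrite -/(D v) => ->.
  rewrite normrM normrN; apply: ler_pM => //.
    exact: (@le_maxJ _ _ (fun i => `|alpha i|)).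
  apply: le_trans (ler_normD _ _) _; apply: lerD; last exact: slopeZ.
  have -> : S u = s u - D u by rewrite /D; ring.
  by apply: le_trans (ler_normB _ _) _; rewrite addrC lerD ?Dm ?sm.
apply: le_trans (Dm t tI) _.
by rewrite ler_pdivlMr ?subr_gt0 //; lra.
Qed.

Theorem theorem3p2 (R : realType) (N : nat) (x y d alpha r : nat -> R)
    (kappa Z0 : R) (f S s : R -> R)
    (hN : (2 <= N)%N)
    (hx : forall i, (1 <= i < N)%N -> x i < x i.+1)
    (hkappa : 0 <= kappa < 1)
    (halpha : forall i, (1 <= i < N)%N -> `|alpha i| <= kappa * hratio N x i)
    (hr : forall i, (1 <= i < N)%N -> -1 < r i)
    (hf : Ck_on (knot_interval N x) 4 f)
    (hy : forall i, (1 <= i <= N)%N -> y i = f (x i))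
    (hS : rational_cubic_FIF N x y d r alpha S)
    (hs : classical_rational_cubic_spline N x y d r s)
    (hSd : forall i, (1 <= i <= N)%N ->
       derive_in_n (knot_interval N x) 1 S (x i) = d i)
    (hsd : forall i, (1 <= i <= N)%N ->
       derive_in_n (knot_interval N x) 1 s (x i) = d i)
    (hZ0 : forall i, (1 <= i < N)%N -> forall tau phi : R,
       0 < `|tau| < kappa * hratio N x i -> 0 <= phi <= 1 ->
       `|derive1 (fun a => Rrat N x y d r i a phi) tau| <= Z0) :
  let I := knot_interval N x in
  let h := maxJ N (hstep x) in
  let c := cmin N r in
  let y1 := fun i => derive_in_n I 1 f (x i) in
  let rmax := maxJ N (fun i => `|r i - 3|) in
  let alphamax := maxJ N (fun i => `|alpha i|) in
  unif_norm I (f \- S)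
  <= h / (4 * c)
       * maxJ N (fun i => Num.max `|y1 i - d i| `|y1 i.+1 - d i.+1|)
     + 1 / (384 * c)
       * (h ^+ 4 * unif_norm I (derive_in_n I 4 f) * (1 + 1 / 4 * rmax)
          + 4 * rmax * (h ^+ 3 * unif_norm I (derive_in_n I 3 f)
                        + 3 * h ^+ 2 * unif_norm I (derive_in_n I 2 f)))
     + alphamax * (unif_norm I s + Z0) / (1 - alphamax).
Proof.
cbv zeta; apply: unif_norm_le => [|t tI].
  by apply: (knot_le _ _ _ _ _ hx) => //; rewrite ltnW /=.
(* Inserting [s t] splits the error into the classical spline error and the effect of the scaling
   factors. *)
rewrite /= -(subrKA (s t)); apply: le_trans (ler_normD _ _) _; apply: lerD.
  exact: classical_spline_error hN hx hr hf hy hs tI.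
exact: FIF_classical_dist hN hx hkappa halpha hS hs hZ0 t tI.
Qed.
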